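(* Let $p$ be a prime number, let $(G,\theta)$ be a $p$-oriented profinite group satisfying formal Hilbert 90, and let $\chi_1,\chi_2,\chi_3\in H^1(G,\mathbb Z/p\mathbb Z)$. The following are equivalent: (1) $\chi_1\cup\chi_2=\chi_2\cup\chi_3=0$ in $H^2(G,\mathbb Z/p\mathbb Z)$; (2) the mod $p$ Massey product $\langle\chi_1,\chi_2,\chi_3\rangle$ is defined; (3) the mod $p$ Massey product $\langle\chi_1,\chi_2,\chi_3\rangle$ vanishes.
   Context: A $p$-oriented profinite group is a pair $(G,\theta)$ with $G$ a profinite group and $\theta\colon G\to\mathbb Z_p^\times$ a continuous homomorphism. For $n\geq 1$, $\mathbb Z/p^n\mathbb Z(1)$ denotes the discrete $G$-module $\mathbb Z/p^n\mathbb Z$ with $g\cdot v=\theta(g)v$. $(G,\theta)$ satisfies formal Hilbert 90 if for every open subgroup $H\subset G$ and every $n\geq1$ the reduction map $H^1(H,\mathbb Z/p^n\mathbb Z(1))\to H^1(H,\mathbb Z/p\mathbb Z(1))$ is surjective. Here $\mathbb Z/p\mathbb Z$ (without twist) has trivial $G$-action. Massey products: For a differential graded ring $(A,\partial)$ and $a_1,\dots,a_n\in H^1(A)$ ($n\ge2$), a defining system for $\langle a_1,\dots,a_n\rangle$ is a collection of elements $a_{ij}\in A^1$, $1\le i<j\le n+1$, $(i,j)\ne(1,n+1)$, with $\partial a_{i,i+1}=0$, $a_{i,i+1}$ representing $a_i$, and $\partial(a_{ij})=-\sum_{l=i+1}^{j-1}a_{il}a_{lj}$ for $i<j-1$; its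 value is the class of the 2-cocycle $-\sum_{l=2}^n a_{1l}a_{l,n+1}$ in $H^2(A)$. The Massey product $\langle a_1,\dots,a_n\rangle\subset H^2(A)$ is the set of all values of defining systems; it is defined if nonempty and vanishes if it contains $0$. Mod $p$ Massey products for $G$ are taken in the differential graded ring of continuous inhomogeneous cochains $C^*(G,\mathbb Z/p\mathbb Z)$ with cup product. *)

(* Defs.v *)
From HB Require Import structures.
From mathcomp Require Import all_boot all_order all_algebra.
From mathcomp Require Import classical_sets boolp topology.
Set Implicit Arguments. Unset Strict Implicit. Unset Printing Implicit Defensive.
Import GRing.Theory.
Local Open Scope classical_set_scope.
Local Open Scope ring_scope.

Record profinite_group (G : topologicalType) := ProfiniteGroup {
  pmul : G -> G -> G;
  pinv : G -> G;
  pone : G;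
  pmulA : forall x y z, pmul x (pmul y z) = pmul (pmul x y) z;
  pmul1g : forall x, pmul pone x = x;
  pmulg1 : forall x, pmul x pone = x;
  pmulVg : forall x, pmul (pinv x) x = pone;
  pmulgV : forall x, pmul x (pinv x) = pone;
  pmul_cont : continuous (fun xy : G * G => pmul xy.1 xy.2);
  pinv_cont : continuous pinv;
  pcompact : compact [set: G];
  phausdorff : hausdorff_space G;
  ptotdisc : totally_disconnected [set: G]
}.

(* Continuity of a map into a discrete module = local constancy. *)
Definition loc_const (T : topologicalType) (M : Type) (f : T -> M) :=
  forall x, \forall y \near x, f y = f x.

(* Local constancy on an (open) subset H, i.e. continuity of the restriction
   to H with the subspace topology, H being open. *)
Definition loc_const_on (T : topologicalType) (M : Type) (H : set T) (f : T -> M) :=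
  forall x, H x -> \forall y \near x, f y = f x.

(* p-orientation.  Z_p^x = lim_m (Z/p^(m+1))^x ; a continuous homomorphism
   theta : G -> Z_p^x is encoded by its compatible family of reductions
   theta m : G -> Z/p^(m+1)Z, each a (locally constant) multiplicative hom. *)
Definition p_orientation (G : topologicalType) (PG : profinite_group G) (p : nat)
  (theta : G -> forall m : nat, 'Z_(p ^ m.+1)) : Prop :=
  [/\ forall g m, (((theta g m.+1 : nat))%:R : 'Z_(p ^ m.+1)) = theta g m,
      forall g h m, theta (pmul PG g h) m = theta g m * theta h m,
      forall m, theta (pone PG) m = 1 &
      forall m, loc_const (fun g => theta g m)].

Definition open_subgroup (G : topologicalType) (PG : profinite_group G) (H : set G) :=
  [/\ open H, H (pone PG),
      forall g h, H g -> H h -> H (pmul PG g h) &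
      forall g, H g -> H (pinv PG g)].

(* Continuous 1-cocycles (crossed homomorphisms) on the open subgroup H with
   values in Z/p^(m+1)Z(1), i.e. g . v = theta(g) v. *)
Definition twisted_cocycle1 (G : topologicalType) (PG : profinite_group G) (p : nat)
  (theta : G -> forall m : nat, 'Z_(p ^ m.+1)) (H : set G) (m : nat)
  (f : G -> 'Z_(p ^ m.+1)) :=
  loc_const_on H f /\
  forall g h, H g -> H h -> f (pmul PG g h) = f g + theta g m * f h.

Definition twisted_coboundary1 (G : topologicalType) (p : nat)
  (theta : G -> forall m : nat, 'Z_(p ^ m.+1)) (H : set G) (m : nat)
  (f : G -> 'Z_(p ^ m.+1)) :=
  exists c : 'Z_(p ^ m.+1), forall g, H g -> f g = theta g m * c - c.

(* Formal Hilbert 90: for every open subgroup H and every n = m+1 >= 1, the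
   reduction H^1(H, Z/p^n(1)) -> H^1(H, Z/p(1)) is surjective. *)
Definition formal_hilbert90 (G : topologicalType) (PG : profinite_group G) (p : nat)
  (theta : G -> forall m : nat, 'Z_(p ^ m.+1)) :=
  forall (H : set G), open_subgroup PG H -> forall (m : nat) (f : G -> 'Z_(p ^ 0.+1)),
    twisted_cocycle1 PG theta H f ->
    exists F : G -> 'Z_(p ^ m.+1),
      twisted_cocycle1 PG theta H F /\
      twisted_coboundary1 theta H (fun g => ((F g : nat)%:R : 'Z_(p ^ 0.+1)) - f g).

Definition cochain1_cont (G : topologicalType) (p : nat) (a : G -> 'Z_p) := loc_const a.
Definition cochain2_cont (G : topologicalType) (p : nat) (a : G * G -> 'Z_p) := loc_const a.

Definition d0 (G : Type) (p : nat) (c : 'Z_p) : G -> 'Z_p := fun _ => c - c.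
Definition d1 (G : topologicalType) (PG : profinite_group G) (p : nat)
  (a : G -> 'Z_p) : G * G -> 'Z_p :=
  fun gh => a gh.2 - a (pmul PG gh.1 gh.2) + a gh.1.
Definition cup11 (G : Type) (p : nat) (a b : G -> 'Z_p) : G * G -> 'Z_p :=
  fun gh => a gh.1 * b gh.2.

Definition cocycle1 (G : topologicalType) (PG : profinite_group G) (p : nat)
  (a : G -> 'Z_p) := cochain1_cont a /\ d1 PG a = (fun _ => 0).

Definition coboundary2 (G : topologicalType) (PG : profinite_group G) (p : nat)
  (c : G * G -> 'Z_p) := exists b : G -> 'Z_p, cochain1_cont b /\ c = d1 PG b.

Definition represents1 (G : topologicalType) (p : nat) (a chi : G -> 'Z_p) :=
  exists c : 'Z_p, (fun g => a g - chi g) = @d0 G p c.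

Definition defining_system3 (G : topologicalType) (PG : profinite_group G) (p : nat)
  (chi1 chi2 chi3 a12 a23 a34 a13 a24 : G -> 'Z_p) :=
  [/\ [/\ cochain1_cont a12, cochain1_cont a23, cochain1_cont a34,
          cochain1_cont a13 & cochain1_cont a24],
      [/\ d1 PG a12 = (fun _ => 0), d1 PG a23 = (fun _ => 0) &
          d1 PG a34 = (fun _ => 0)],
      [/\ represents1 a12 chi1, represents1 a23 chi2 & represents1 a34 chi3],
      d1 PG a13 = (fun gh => - cup11 a12 a23 gh) &
      d1 PG a24 = (fun gh => - cup11 a23 a34 gh)].

Definition ds_value3 (G : Type) (p : nat) (a12 a34 a13 a24 : G -> 'Z_p) :
  G * G -> 'Z_p := fun gh => - (cup11 a12 a24 gh + cup11 a13 a34 gh).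

Definition massey3_defined (G : topologicalType) (PG : profinite_group G) (p : nat)
  (chi1 chi2 chi3 : G -> 'Z_p) :=
  exists a12 a23 a34 a13 a24 : G -> 'Z_p,
    defining_system3 PG chi1 chi2 chi3 a12 a23 a34 a13 a24.

Definition massey3_vanishes (G : topologicalType) (PG : profinite_group G) (p : nat)
  (chi1 chi2 chi3 : G -> 'Z_p) :=
  exists a12 a23 a34 a13 a24 : G -> 'Z_p,
    defining_system3 PG chi1 chi2 chi3 a12 a23 a34 a13 a24 /\
    coboundary2 PG (ds_value3 a12 a34 a13 a24).

(* Main.v *)
Require Import Defs.
From mathcomp Require Import all_boot all_order all_algebra.
From mathcomp Require Import classical_sets boolp topology.
From mathcomp Require Import ring.
Set Implicit Arguments. Unset Strict Implicit. Unset Printing Implicit Defensive.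
Import GRing.Theory.
Local Open Scope classical_set_scope.
Local Open Scope ring_scope.

(** Only coefficients Z/p^2(1) are needed. By Shapiro's lemma, formal Hilbert 90 lets
    every cocycle with values in the functions Y -> Z/p(1) on a finite G-set Y lift to
    Z/p^2(1). Let G act on pairs (x, z) in (Z/p)^2 by translation by (chi1, chi3). The
    relations chi1 chi2 = 0 = chi2 chi3 produce cocycles alpha in functions of x and
    gamma in functions of z, over Z/p^2(1), with the same sum, which lifts chi2. So
    alpha - gamma has norm zero for the diagonal translation and, modulo p, equals
    w(x+1,z+1) - w(x,z) for a cocycle w in functions of (x, z). The first moment of w in
    x, corrected by the second moment of gamma in z, is a function of degree at most one
    in x and in z whose xz-coefficient is -chi2, and its other coefficients are, up to sign
    and products of characters, the entries of a homomorphism to unitriangular 4x4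
    matrices extending (chi1, chi2, chi3). *)

(** * Arithmetic of the extension of Z/p by Z/p inside Z/p^2, and sums over Z/p *)

Section ModP.
Context (p : nat) (p_prime : prime p).

Let p_gt1 : (1 < p)%N. Proof. exact: prime_gt1. Qed.
Let p2_gt1 : (1 < p ^ 2)%N.
Proof. by rewrite (ltn_trans p_gt1) // -{1}(expn1 p) ltn_exp2l. Qed.

Definition redp (x : 'Z_(p ^ 2)) : 'Z_p := (x : nat)%:R.
Definition liftp (x : 'Z_p) : 'Z_(p ^ 2) := (x : nat)%:R.
Definition inclp (x : 'Z_p) : 'Z_(p ^ 2) := p%:R * liftp x.

Lemma redp_nat n : redp n%:R = n%:R.
Proof.
rewrite /redp -[RHS]Zp_nat_mod // val_Zp_nat // -Zp_nat_mod //.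
by rewrite modn_dvdm ?dvdn_exp // Zp_nat_mod.
Qed.

Lemma liftpK : cancel liftp redp.
Proof. by move=> x; rewrite redp_nat natr_Zp. Qed.

Lemma redpD x y : redp (x + y) = redp x + redp y.
Proof. by rewrite -[x]natr_Zp -[y]natr_Zp -natrD !redp_nat natrD. Qed.

Lemma redpM x y : redp (x * y) = redp x * redp y.
Proof. by rewrite -[x]natr_Zp -[y]natr_Zp -natrM !redp_nat natrM. Qed.

Lemma redp0 : redp 0 = 0. Proof. exact: (redp_nat 0). Qed.

Lemma redpN x : redp (- x) = - redp x.
Proof. by apply/eqP; rewrite -subr_eq0 opprK -redpD addNr redp0. Qed.

Lemma redp_sum (I : finType) (F : I -> 'Z_(p ^ 2)) :
  redp (\sum_i F i) = \sum_i redp (F i).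
Proof. exact: (big_morph redp redpD redp0). Qed.

Lemma natp_eq0 : p%:R = 0 :> 'Z_p. Proof. exact: pchar_Zp. Qed.

Lemma natp2_mul n : p%:R * n%:R = 0 :> 'Z_(p ^ 2) <-> n%:R = 0 :> 'Z_p.
Proof.
have E q m : (1 < q)%N -> m%:R = 0 :> 'Z_q <-> (q %| m)%N.
  move=> q1; rewrite /dvdn -val_Zp_nat //; split=> [->//|/eqP h].
  exact: val_inj.
by rewrite -natrM !E // expnS expn1 dvdn_pmul2l // ltnW.
Qed.

(** [x] and [liftp (redp x)] differ by a multiple of p. Writing elements of Z/p as [redp (liftp x)],
    this makes [inclp] additive and linear although [liftp] is not additive. *)
Lemma inclp_red x : inclp (redp x) = p%:R * x.
Proof.
apply/eqP; rewrite -subr_eq0 -mulrBr; apply/eqP.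
rewrite -[_ - _]natr_Zp; apply/natp2_mul.
by rewrite -redp_nat natr_Zp redpD redpN liftpK subrr.
Qed.

Lemma inclpD x y : inclp (x + y) = inclp x + inclp y.
Proof. by rewrite -{1}(liftpK x) -{1}(liftpK y) -redpD inclp_red mulrDr. Qed.

Lemma inclp0 : inclp 0 = 0.
Proof. by rewrite -redp0 inclp_red mulr0. Qed.

Lemma inclpN x : inclp (- x) = - inclp x.
Proof. by apply/eqP; rewrite -subr_eq0 opprK -inclpD addNr inclp0. Qed.

Lemma inclp_sum (I : finType) (F : I -> 'Z_p) :
  inclp (\sum_i F i) = \sum_i inclp (F i).
Proof. exact: (big_morph inclp inclpD inclp0). Qed.

Lemma inclpM x y : inclp (redp x * y) = x * inclp y.
Proof. by rewrite -{1}(liftpK y) -redpM inclp_red mulrCA. Qed.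

Lemma inclp_inj : injective inclp.
Proof.
move=> x y; rewrite -(liftpK x) -(liftpK y) !inclp_red.
move/eqP; rewrite -subr_eq0 -mulrBr -[_ - _]natr_Zp => /eqP/natp2_mul.
by rewrite -redp_nat natr_Zp redpD redpN => /eqP; rewrite subr_eq0 => /eqP.
Qed.

(** Inverse of [inclp] on the kernel of [redp]; its values elsewhere carry no meaning. *)
Definition quop (x : 'Z_(p ^ 2)) : 'Z_p := ((x : nat) %/ p)%:R.

Lemma inclp_quo x : redp x = 0 -> inclp (quop x) = x.
Proof.
move=> rx0; rewrite /quop -[in LHS](redp_nat _) inclp_red -natrM mulnC divnK ?natr_Zp //.
rewrite /dvdn -(val_Zp_nat p_gt1); move: rx0; rewrite /redp => ->.
by [].
Qed.

Lemma card_Zp_type : #|'Z_p| = p.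
Proof. by rewrite card_ord Zp_cast. Qed.

Lemma sum_constZ (R : pzRingType) (x : R) : \sum_(i : 'Z_p) x = p%:R * x.
Proof. by rewrite sumr_const card_Zp_type mulr_natl. Qed.

Lemma sum_shiftZ (V : nmodType) (s : 'Z_p) (F : 'Z_p -> V) :
  \sum_(i : 'Z_p) F (i + s) = \sum_(i : 'Z_p) F i.
Proof. by rewrite [RHS](reindex_inj (addIr s)). Qed.

(** The element 1 generates ['Z_p]. Serves to recognize constant and affine functions by their first
    differences. *)
Lemma eq_of_stepZ (V : zmodType) (f h : 'Z_p -> V) :
  f 0 = h 0 -> (forall z, f (z + 1) - f z = h (z + 1) - h z) -> f =1 h.
Proof.
move=> f0 step z; rewrite -[z]natr_Zp; elim: (z : nat) => [//|n IH].
by apply: (addIr (- f n%:R)); rewrite -natr1 step IH.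
Qed.

Definition psumZ (V : zmodType) (h : 'Z_p -> V) (i : 'Z_p) : V :=
  \sum_(0 <= j < i) h j%:R.

(** Additive Hilbert 90 for translation by 1: the vanishing sum enters when [i + 1] wraps around to
    0, where the partial sum is empty. *)
Lemma psumZS (V : zmodType) (h : 'Z_p -> V) :
  \sum_(i : 'Z_p) h i = 0 -> forall i, psumZ h (i + 1) = psumZ h i + h i.
Proof.
move=> h0 i; have [i_lt|] := ltnP i.+1 p.
  rewrite /psumZ; have -> : (i + 1)%R = i.+1 :> nat.
    by rewrite -[i in LHS]natr_Zp natr1 val_Zp_nat // modn_small.
  by rewrite big_nat_recr //= natr_Zp.
move=> i_ge; have Ei : i.+1 = p.
  by apply/eqP; rewrite eqn_leq i_ge andbT -[X in (_ <= X)%N]Zp_cast.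
have -> : i + 1 = 0 by rewrite -[i]natr_Zp natr1 Ei natp_eq0.
rewrite {1}/psumZ big_geq //; apply/esym; rewrite -[RHS]h0 /psumZ.
rewrite -[X in _ + h X]natr_Zp -(big_nat_recr _ _ (fun j => h j%:R)) //=.
rewrite big_mkord; have -> : (i.+1 = (Zp_trunc p).+2)%N by rewrite [RHS]Zp_cast.
by apply: eq_bigr => j _; rewrite natr_Zp.
Qed.

Lemma unitZ_neq0 (u : 'Z_p) : u != 0 -> u \is a GRing.unit.
Proof.
move=> u0; rewrite -[u]natr_Zp unitZpE // prime_coprime //.
apply: contra u0 => /dvdnP [m um]; rewrite -[u]natr_Zp um natrM natp_eq0 mulr0.
exact: eqxx.
Qed.
Lemma sum_unitZ : \sum_(u : 'Z_p) u * u^-1 = - 1.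
Proof.
rewrite (bigD1 0) //= mul0r add0r.
rewrite (eq_bigr (fun=> 1)) => [|u u0].
  rewrite sumr_const cardC1 card_Zp_type.
  by apply/eqP; rewrite -subr_eq0 opprK natr1 prednK ?natp_eq0 // prime_gt0.
by rewrite divrr ?unitZ_neq0.
Qed.

End ModP.

(** * Locally constant maps *)

Lemma loc_const_comp (T : topologicalType) (M N : Type) (phi : M -> N) (f : T -> M) :
  loc_const f -> loc_const (fun x => phi (f x)).
Proof. by move=> lf x; apply: filterS (lf x) => y ->. Qed.

Lemma loc_const_pair (T : topologicalType) (M N : Type) (f : T -> M) (h : T -> N) :
  loc_const f -> loc_const h -> loc_const (fun x => (f x, h x)).
Proof. by move=> lf lh x; apply: filterS2 (lf x) (lh x) => y -> ->. Qed.

Lemma loc_const_comp2 (T : topologicalType) (M N L : Type) (phi : M -> N -> L)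
    (f : T -> M) (h : T -> N) :
  loc_const f -> loc_const h -> loc_const (fun x => phi (f x) (h x)).
Proof.
by move=> lf lh; apply: (loc_const_comp (fun q => phi q.1 q.2) (loc_const_pair lf lh)).
Qed.

Lemma loc_const_comp3 (T : topologicalType) (M N L K : Type) (phi : M -> N -> L -> K)
    (f : T -> M) (h : T -> N) (k : T -> L) :
  loc_const f -> loc_const h -> loc_const k -> loc_const (fun x => phi (f x) (h x) (k x)).
Proof.
move=> lf lh lk.
exact: (loc_const_comp2 (fun q => phi q.1 q.2) (loc_const_pair lf lh) lk).
Qed.

Lemma loc_const_fun (T : topologicalType) (Y : finType) (M : Type) (f : T -> Y -> M) :
  (forall y, loc_const (fun x => f x y)) -> loc_const f.
Proof.
move=> lf x; apply: filterS (filter_forall _ (fun y => lf y x)) => x' h.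
exact: funext.
Qed.

(* Cocycles with values in the G-module of functions [Y -> R], on which G acts by
   [(g . f) y = th g * f (act y g)] for a right action [act] of G on [Y]. *)
Definition tcocycle (G : topologicalType) (PG : profinite_group G) (R : pzRingType)
    (th : G -> R) (Y : Type) (act : Y -> G -> Y) (f : G -> Y -> R) :=
  loc_const f /\
  forall g h y, f (pmul PG g h) y = f g y + th g * f h (act y g).

(** * Lifting twisted cocycles from Z/p(1) to Z/p^2(1) *)

Section Lift.
Context (p : nat) (p_prime : prime p) (G : topologicalType) (PG : profinite_group G)
  (theta : G -> forall m : nat, 'Z_(p ^ m.+1)).
Hypotheses (theta_or : p_orientation PG theta) (H90 : formal_hilbert90 PG theta).

(** Index m of [theta] stands for the modulus p^(m+1); [p ^ 1] is convertible with [p]. *)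
Definition theta1 (g : G) : 'Z_p := theta g 0.
Definition theta2 (g : G) : 'Z_(p ^ 2) := theta g 1.

Lemma theta2M g h : theta2 (pmul PG g h) = theta2 g * theta2 h.
Proof. by have [_ h1 _ _] := theta_or; exact: h1. Qed.
Lemma theta21 : theta2 (pone PG) = 1.
Proof. by have [_ _ h1 _] := theta_or; exact: (h1 _). Qed.
Lemma theta2_const : loc_const theta2.
Proof. by have [_ _ _ h1] := theta_or; exact: (h1 1%N). Qed.
Lemma theta1M g h : theta1 (pmul PG g h) = theta1 g * theta1 h.
Proof. by have [_ h1 _ _] := theta_or; exact: (h1 g h 0%N). Qed.
Lemma theta11 : theta1 (pone PG) = 1.
Proof. by have [_ _ h1 _] := theta_or; exact: (h1 0%N). Qed.
Lemma theta1_const : loc_const theta1.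
Proof. by have [_ _ _ h1] := theta_or; exact: (h1 0%N). Qed.
Lemma redp_theta g : redp (theta2 g) = theta1 g.
Proof. by have [h1 _ _ _] := theta_or; exact: (h1 g 0%N). Qed.

Lemma theta1_unit g : theta1 g \is a GRing.unit.
Proof.
apply/unitrP; exists (theta1 (pinv PG g)).
by rewrite -!theta1M pmulVg pmulgV theta11.
Qed.

(** Formal Hilbert 90 lifts the class of [f]; subtracting a lift of the remaining coboundary gives a
    lift of [f] itself. *)
Lemma cocycle1_lift (H : set G) (f : G -> 'Z_p) :
  open_subgroup PG H -> loc_const f ->
  (forall g h, H g -> H h -> f (pmul PG g h) = f g + theta1 g * f h) ->
  exists F : G -> 'Z_(p ^ 2),
    [/\ loc_const_on H F,
        forall g h, H g -> H h -> F (pmul PG g h) = F g + theta2 g * F h &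
        forall g, H g -> redp (F g) = f g].
Proof.
move=> Hop lf cf.
have [] := @H90 H Hop 1%N f.
  by split=> [x _|]; [exact: lf|exact: cf].
move=> F [[lF cF] [c Fc]].
exists (fun g => F g - (theta2 g * liftp c - liftp c)); split.
- move=> x Hx; apply: filterS2 (lF x Hx) (theta2_const x) => y -> ->.
  by [].
- move=> g h Hg Hh; rewrite cF // theta2M -/(theta2 g); ring.
move=> g Hg; have := Fc g Hg; rewrite -/(redp (F g)) -/(theta1 g) => /eqP.
rewrite subr_eq => /eqP Ef.
by rewrite !(redpD, redpN, redpM) // liftpK // redp_theta Ef addrAC subrr add0r.
Qed.

Lemma translate_cvg a b (x : G) :
  (fun g => pmul PG (pmul PG a g) b) @ x --> pmul PG (pmul PG a x) b.
Proof.
have mulc c : {for x, continuous (fun g => pmul PG c g)}.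
  apply: (@cvg_comp _ _ _ (fun g => (c, g)) (fun q => pmul PG q.1 q.2) _ (nbhs (c, x))).
    exact: (cvg_pair (cvg_cst _) cvg_id).
  exact: (@pmul_cont _ PG (c, x)).
apply: (@cvg_comp _ _ _ (fun g => (pmul PG a g, b)) (fun q => pmul PG q.1 q.2) _
          (nbhs (pmul PG a x, b))).
  by apply: cvg_pair; [exact: mulc|exact: cvg_cst].
exact: (@pmul_cont _ PG (pmul PG a x, b)).
Qed.

(* Shapiro's lemma reduces the lifting of a cocycle with values in the functions
   on Y to formal Hilbert 90 for the stabilizers of orbit representatives. *)
Lemma tcocycle_lift (Y : finType) (act : Y -> G -> Y) (f : G -> Y -> 'Z_p) :
  (forall y, act y (pone PG) = y) ->
  (forall y g h, act y (pmul PG g h) = act (act y g) h) ->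
  loc_const (fun g y => act y g) ->
  tcocycle PG theta1 act f ->
  exists2 F : G -> Y -> 'Z_(p ^ 2),
    tcocycle PG theta2 act F & forall g y, redp (F g y) = f g y.
Proof.
move=> act1 actM lact [lf cf].
have lacty y : loc_const (fun g => act y g) by exact: (loc_const_comp (fun F => F y) lact).
pose orb y z := `[< exists g, act z g = y >].
have [r [r_orb rE]] : exists r : Y -> Y,
    (forall y, orb y (r y)) /\ (forall y g, r (act y g) = r y).
  (* [pick] sees only the predicate [orb y], which is the same along an orbit; the default is never
     reached, as [y] lies in its own orbit. *)
  exists (fun y => odflt y [pick z | orb y z]); split=> [y|y g].
    by case: pickP => [//|/(_ y)] /asboolP []; exists (pone PG).
  have -> : [pick z | orb (act y g) z] = [pick z | orb y z].
    apply: eq_pick => z; apply/asboolP/asboolP => -[h hE].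
      by exists (pmul PG h (pinv PG g)); rewrite actM hE -actM pmulgV act1.
    by exists (pmul PG h g); rewrite actM hE.
  by case: pickP => [//|/(_ y)] /asboolP []; exists (pone PG).
have [s sE] : exists s : Y -> G, forall y, act (r y) (s y) = y.
  have /choice [s sP] : forall y, exists g, act (r y) g = y.
    by move=> y; apply/asboolP/r_orb.
  by exists s.
pose H z : set G := [set h | act z h = z].
have Hsub z : open_subgroup PG (H z).
  split; rewrite /H /=.
  - rewrite openE => h /= hz; apply: filterS (lacty z h) => h' /=.
    by rewrite hz.
  - exact: act1.
  - by move=> g h gz hz; rewrite actM gz.
  - by move=> g gz; rewrite -{1}gz -actM pmulgV act1.
have lfy y : loc_const (fun g => f g y) by exact: (loc_const_comp (fun F => F y) lf).
have [Phi PhiP] : exists Phi : Y -> G -> 'Z_(p ^ 2), forall z,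
    [/\ loc_const_on (H z) (Phi z),
        forall g h, H z g -> H z h ->
          Phi z (pmul PG g h) = Phi z g + theta2 g * Phi z h &
        forall g, H z g -> redp (Phi z g) = f g z].
  have /choice [Phi PhiP] : forall z, exists F : G -> 'Z_(p ^ 2),
      [/\ loc_const_on (H z) F,
          forall g h, H z g -> H z h -> F (pmul PG g h) = F g + theta2 g * F h &
          forall g, H z g -> redp (F g) = f g z].
    move=> z; apply: cocycle1_lift => // g h gz hz.
    by rewrite cf (_ : act z g = z).
  by exists Phi.
(* Schreier elements: [hh g y] stabilizes [r y] and measures the failure of [s] to be
   equivariant. *)
pose hh g y := pmul PG (pmul PG (s y) g) (pinv PG (s (act y g))).
have hhH g y : H (r y) (hh g y).
  rewrite /H /hh /= !actM sE -{1}(sE (act y g)) rE -actM pmulgV act1 //.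
have hhE g y : pmul PG (hh g y) (s (act y g)) = pmul PG (s y) g.
  by rewrite /hh -pmulA pmulVg pmulg1.
have hhM g k y : hh (pmul PG g k) y = pmul PG (hh g y) (hh k (act y g)).
  by rewrite /hh actM !pmulA -(pmulA _ _ (pinv PG (s (act y g)))) pmulVg pmulg1.
have thV g : theta2 (pinv PG g) * theta2 g = 1 by rewrite -theta2M pmulVg theta21.
(* Expanding [f] at [r y] on both sides of [hhE] expresses [f g y] by [f] on the stabilizer and at
   values of [s]. [F] puts [Phi] for the former and arbitrary lifts for the latter. *)
pose F g y := theta2 (pinv PG (s y)) *
  (Phi (r y) (hh g y) + theta2 (hh g y) * liftp (f (s (act y g)) (r y))
    - liftp (f (s y) (r y))).
exists F; last first.
  move=> g y; have [_ _ Ph] := PhiP (r y).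
  rewrite /F !(redpM, redpD, redpN) // Ph // !liftpK // !redp_theta.
  have e1 := cf (hh g y) (s (act y g)) (r y).
  rewrite hhH hhE cf sE in e1; rewrite -e1 addrAC subrr add0r mulrA.
  by rewrite -theta1M pmulVg theta11 mul1r.
split=> [|g k y]; last first.
  rewrite /F hhM; have [_ Ph _] := PhiP (r y).
  rewrite Ph //; last by rewrite -(rE y g); exact: hhH.
  rewrite rE actM theta2M.
  have -> : theta2 g * (theta2 (pinv PG (s (act y g))) *
      (Phi (r y) (hh k (act y g)) + theta2 (hh k (act y g)) *
        liftp (f (s (act (act y g) k)) (r y)) - liftp (f (s (act y g)) (r y)))) =
    theta2 (pinv PG (s y)) * theta2 (hh g y) *
      (Phi (r y) (hh k (act y g)) + theta2 (hh k (act y g)) *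
        liftp (f (s (act (act y g) k)) (r y)) - liftp (f (s (act y g)) (r y))).
    by rewrite mulrA; congr (_ * _); rewrite /hh -!theta2M !pmulA pmulVg pmul1g.
  ring.
apply: loc_const_fun => y g0.
have [Pl _ _] := PhiP (r y).
(* Near [g0] the point [act y g] is constant, so [hh g y] is a two-sided translate of [g]. *)
have cvh := @translate_cvg (s y) (pinv PG (s (act y g0))) g0.
pose h' g := pmul PG (pmul PG (s y) g) (pinv PG (s (act y g0))).
have e1 : \forall g \near g0, Phi (r y) (h' g) = Phi (r y) (h' g0).
  exact: (cvh _ (Pl _ (hhH g0 y))).
have e2 : \forall g \near g0, theta2 (h' g) = theta2 (h' g0).
  exact: (cvh _ (theta2_const (h' g0))).
apply: filterS2 e2 (filterI e1 (lacty y g0)) => g t2 [t1 ag].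
by rewrite /F /hh ag -!/(h' _) t1 t2.
Qed.
End Lift.

(** * Norms and Hilbert 90 for translations of Z/p *)

Definition is_char (G : topologicalType) (PG : profinite_group G) (R : pzRingType)
    (a : G -> R) :=
  loc_const a /\ forall g h, a (pmul PG g h) = a g + a h.

Section Massey.
Context (p : nat) (p_prime : prime p) (G : topologicalType) (PG : profinite_group G)
  (theta : G -> forall m : nat, 'Z_(p ^ m.+1)).
Hypotheses (theta_or : p_orientation PG theta) (H90 : formal_hilbert90 PG theta).

Let th1 : G -> 'Z_p := theta1 theta.
Let th2 : G -> 'Z_(p ^ 2) := theta2 theta.

(* The factor ['Z_p] acted on by theta untwists the coefficients: for a character
   [b], the functions [u |-> u^-1 * b g] form a twisted cocycle, and
   [F |-> sum_u u * F u] goes back to trivial coefficients (see [sum_untwist]). *)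
Definition act_mul (u : 'Z_p) (g : G) : 'Z_p := theta1 theta g * u.
Definition act_pair (psi : G -> 'Z_p) (q : 'Z_p * 'Z_p) (g : G) : 'Z_p * 'Z_p :=
  (theta1 theta g * q.1, q.2 + psi g).

Lemma is_char1 (R : pzRingType) (a : G -> R) : is_char PG a -> a (pone PG) = 0.
Proof.
move=> [_ ha]; have := ha (pone PG) (pone PG); rewrite pmul1g => /eqP.
by rewrite -subr_eq0 opprD addrA subrr sub0r oppr_eq0 => /eqP.
Qed.

Lemma lift_mul (f : G -> 'Z_p -> 'Z_p) : tcocycle PG th1 act_mul f ->
  exists2 F : G -> 'Z_p -> 'Z_(p ^ 2),
    tcocycle PG th2 act_mul F & forall g y, redp (F g y) = f g y.
Proof.
apply: (tcocycle_lift p_prime theta_or H90) => [y|y g h|].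
- by rewrite /act_mul (theta11 theta_or) mul1r.
- by rewrite /act_mul (theta1M theta_or) (mulrC (theta1 theta g)) mulrA.
exact: (loc_const_comp (fun t y => t * y) (theta1_const theta_or)).
Qed.

Lemma lift_pair (psi : G -> 'Z_p) (f : G -> 'Z_p * 'Z_p -> 'Z_p) :
  is_char PG psi -> tcocycle PG th1 (act_pair psi) f ->
  exists2 F : G -> 'Z_p * 'Z_p -> 'Z_(p ^ 2),
    tcocycle PG th2 (act_pair psi) F & forall g y, redp (F g y) = f g y.
Proof.
move=> hpsi; apply: (tcocycle_lift p_prime theta_or H90) => [[u x]|[u x] g h|].
- by rewrite /act_pair (theta11 theta_or) mul1r (is_char1 hpsi) addr0.
- rewrite /act_pair (theta1M theta_or) (hpsi.2 g h) /= (mulrC (theta1 theta g)).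
  by rewrite mulrA addrA.
exact: (loc_const_comp2 (fun t s q => (t * q.1, q.2 + s)) (theta1_const theta_or) hpsi.1).
Qed.

Lemma theta1_mul_inv g u : th1 g * (th1 g * u)^-1 = u^-1.
Proof.
have thu : th1 g \is a GRing.unit := theta1_unit theta_or g.
(* At u = 0 both sides vanish by the convention 0^-1 = 0. *)
have [->|u0] := eqVneq u 0; first by rewrite mulr0 invr0 mulr0.
by rewrite invrM // ?unitZ_neq0 // mulrCA divrr // mulr1.
Qed.

(** [inclp] is injective and compatible with theta, so the cocycle identity can be checked after
    applying it. *)
Lemma quop_cocycle (Y : Type) (act : Y -> G -> Y) (F : G -> Y -> 'Z_(p ^ 2)) :
  tcocycle PG th2 act F -> (forall g y, redp (F g y) = 0) ->
  tcocycle PG th1 act (fun g y => quop (F g y)).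
Proof.
move=> [lF cF] F0; split; first exact: (loc_const_comp (fun f y => quop (f y)) lF).
move=> g h y; apply: (inclp_inj p_prime).
rewrite (inclpD p_prime) /th1 -(redp_theta theta_or) (inclpM p_prime).
by rewrite !inclp_quo.
Qed.

(* [H] lifts the cocycle [u^-1 * (eta + x b)], and [B - (H (x + 1) - H x)] is divisible
   by p; summing its quotient over [x] gives [B] modulo p. *)
Lemma norm_lift (a b eta : G -> 'Z_p) (B : G -> 'Z_p -> 'Z_(p ^ 2)) :
  is_char PG a -> is_char PG b -> loc_const eta ->
  (forall g h, eta (pmul PG g h) = eta g + eta h + a g * b h) ->
  tcocycle PG th2 act_mul B -> (forall g u, redp (B g u) = u^-1 * b g) ->
  exists2 alpha : G -> 'Z_p * 'Z_p -> 'Z_(p ^ 2),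
    tcocycle PG th2 (act_pair a) alpha & forall g u, \sum_(x : 'Z_p) alpha g (u, x) = B g u.
Proof.
move=> ha hb leta ceta hB redB.
have [H [lH cH] redH] : exists2 H : G -> 'Z_p * 'Z_p -> 'Z_(p ^ 2),
    tcocycle PG th2 (act_pair a) H &
    forall g q, redp (H g q) = q.1^-1 * (eta g + q.2 * b g).
  apply: (lift_pair ha); split.
    exact: (loc_const_comp2 (fun e c q => q.1^-1 * (e + q.2 * c)) leta hb.1).
  move=> g h [u x] /=; rewrite ceta (hb.2 g h) mulrA theta1_mul_inv; ring.
have rN x : redp (- x) = - redp x := redpN p_prime x.
have rD x y : redp (x + y) = redp x + redp y := redpD p_prime x y.
pose F g (q : 'Z_p * 'Z_p) := B g q.1 - (H g (q.1, q.2 + 1) - H g q).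
have hF : tcocycle PG th2 (act_pair a) F.
  split; first exact: (loc_const_comp2
    (fun Bg Hg q => Bg q.1 - (Hg (q.1, q.2 + 1) - Hg q)) hB.1 lH).
  move=> g h [u x]; rewrite /F /= hB.2 !cH /act_pair /act_mul /= (addrAC x 1); ring.
have F0 g q : redp (F g q) = 0.
  by rewrite /F !(rD, rN) redB !redH /=; ring.
have [A [lA cA] redA] := lift_pair ha (quop_cocycle hF F0).
have sumF g u : \sum_(x : 'Z_p) F g (u, x) = p%:R * B g u.
  rewrite [LHS](_ : _ = \sum_(x : 'Z_p) (B g u - (H g (u, x + 1) - H g (u, x)))) //.
  rewrite sumrB (sum_constZ p_prime) sumrB.
  by rewrite (sum_shiftZ _ (fun x => H g (u, x))) subrr subr0.
pose E g u : 'Z_(p ^ 2) := \sum_(x : 'Z_p) A g (u, x) - B g u.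
have hE : tcocycle PG th2 act_mul E.
  split; first exact: (loc_const_comp2 (fun Ag Bg u => \sum_(x : 'Z_p) Ag (u, x) - Bg u) lA hB.1).
  move=> g h u; rewrite /E hB.2 (eq_bigr (fun x => A g (u, x) + th2 g * A h (th1 g * u, x + a g))).
    rewrite big_split /= -mulr_sumr (sum_shiftZ _ (fun x => A h (th1 g * u, x))).
    rewrite /act_mul -/th1; ring.
  by move=> x _; rewrite cA.
have E0 g u : redp (E g u) = 0.
  apply: (inclp_inj p_prime); rewrite (inclp0 p_prime) /E rD rN (redp_sum p_prime).
  rewrite (inclpD p_prime) (inclpN p_prime) (inclp_sum p_prime).
  rewrite (eq_bigr (fun x => F g (u, x))) => [|x _]; last by rewrite redA inclp_quo.
  by rewrite sumF (inclp_red p_prime) subrr.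
have [E' [lE' cE'] redE'] := lift_mul (quop_cocycle hE E0).
(* [E'] does not depend on x, so subtracting it removes [p * E' = E] from the sum, which becomes
   exactly [B]. *)
exists (fun g q => A g q - E' g q.1).
  split; first exact: (loc_const_comp2 (fun Ag Eg q => Ag q - Eg q.1) lA lE').
  by move=> g h [u x]; rewrite cA cE' /act_pair /act_mul /=; ring.
move=> g u; rewrite [LHS](_ : _ = \sum_(x : 'Z_p) (A g (u, x) - E' g u)) // sumrB (sum_constZ p_prime).
by rewrite -(inclp_red p_prime) redE' inclp_quo // /E opprB addrC subrK.
Qed.

(* Hilbert 90 along the diagonal [(x, z) |-> (x + 1, z + 1)]: [alpha - gamma] has
   norm 0, hence is the difference of a cochain [om], whose coboundary [del] is
   invariant along the diagonal. The norm [nu] of [om] has coboundary [p * del], so it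
   is a cocycle modulo p; lifting it shows that [del] is a coboundary modulo p. *)
Lemma diagonal_lift (a c : G -> 'Z_p) (alpha gamma : G -> 'Z_p * 'Z_p -> 'Z_(p ^ 2)) :
  is_char PG a -> is_char PG c ->
  tcocycle PG th2 (act_pair a) alpha -> tcocycle PG th2 (act_pair c) gamma ->
  (forall g u, \sum_(x : 'Z_p) alpha g (u, x) = \sum_(z : 'Z_p) gamma g (u, z)) ->
  exists w : G -> 'Z_p -> 'Z_p -> 'Z_p -> 'Z_p,
  [/\ loc_const w,
      forall g h u x z, w (pmul PG g h) u x z =
        w g u x z + th1 g * w h (th1 g * u) (x + a g) (z + c g) &
      forall g u x z, w g u (x + 1) (z + 1) - w g u x z =
        redp (alpha g (u, x)) - redp (gamma g (u, z))].
Proof.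
move=> ha hc [lal cal] [lga cga] sumE.
pose d g := c g - a g.
have hd : is_char PG d.
  split; first exact: (loc_const_comp2 (fun s t => s - t) hc.1 ha.1).
  by move=> g h; rewrite /d hc.2 ha.2; ring.
(* Coordinates: [i = x] along the diagonal and [y = z - x] across it; [y] is translated by [d]. *)
pose df g u y i : 'Z_(p ^ 2) := alpha g (u, i) - gamma g (u, i + y).
pose om g u y := psumZ (df g u y).
have df0 g u y : \sum_(i : 'Z_p) df g u y i = 0.
  by rewrite /df sumrB (sum_shiftZ _ (fun i => gamma g (u, i))) sumE subrr.
have omS g u y i : om g u y (i + 1) = om g u y i + df g u y i.
  exact: (psumZS p_prime).
have dfM g h u y i : df (pmul PG g h) u y i =
    df g u y i + th2 g * df h (th1 g * u) (y + d g) (i + a g).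
  rewrite /df cal cga /act_pair /= -/(th1 g).
  have -> : i + a g + (y + d g) = i + y + c g by rewrite /d; ring.
  ring.
pose del g h u y i : 'Z_(p ^ 2) :=
  om (pmul PG g h) u y i - om g u y i - th2 g * om h (th1 g * u) (y + d g) (i + a g).
have delE g h u y i : del g h u y i = del g h u y 0.
  suff: del g h u y =1 fun=> del g h u y 0 by apply.
  apply: eq_of_stepZ => // {}i.
  rewrite subrr /del !omS (addrAC i 1) omS dfM; ring.
pose nu g (q : 'Z_p * 'Z_p) : 'Z_(p ^ 2) := \sum_(i : 'Z_p) om g q.1 q.2 i.
have nuE g h q : nu (pmul PG g h) q =
    nu g q + th2 g * nu h (act_pair d q g) + p%:R * del g h q.1 q.2 0.
  rewrite -(sum_constZ p_prime) -(eq_bigr _ (fun i _ => delE g h q.1 q.2 i)).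
  rewrite /del !sumrB -mulr_sumr (sum_shiftZ _ (om h (th1 g * q.1) (q.2 + d g))).
  rewrite /nu /act_pair /= -/(th1 g); ring.
have rN x : redp (- x) = - redp x := redpN p_prime x.
have rD x y : redp (x + y) = redp x + redp y := redpD p_prime x y.
have rM x y : redp (x * y) = redp x * redp y := redpM p_prime x y.
have rp : redp (p%:R : 'Z_(p ^ 2)) = 0 by rewrite redp_nat // natp_eq0.
have lom : loc_const om.
  exact: (loc_const_comp2 (fun al ga u y => psumZ (fun i => al (u, i) - ga (u, i + y)))
            lal lga).
have lnu : loc_const nu.
  exact: (loc_const_comp (fun o q => \sum_(i : 'Z_p) o q.1 q.2 i) lom).
have [N [lN cN] redN] : exists2 N : G -> 'Z_p * 'Z_p -> 'Z_(p ^ 2),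
    tcocycle PG th2 (act_pair d) N & forall g q, redp (N g q) = redp (nu g q).
  apply: (lift_pair hd); split.
    exact: (loc_const_comp (fun n q => redp (n q)) lnu).
  by move=> g h q; rewrite nuE !(rD, rM) rp mul0r addr0 (redp_theta theta_or).
pose mu g q := quop (nu g q - N g q).
have muE g q : inclp (mu g q) = nu g q - N g q.
  by rewrite inclp_quo // rD rN redN subrr.
have lmu : loc_const mu.
  exact: (loc_const_comp2 (fun n m q => quop (n q - m q)) lnu lN).
have muM g h q : mu (pmul PG g h) q =
    mu g q + th1 g * mu h (act_pair d q g) + redp (del g h q.1 q.2 0).
  apply: (inclp_inj p_prime); rewrite !(inclpD p_prime) (inclp_red p_prime).
  rewrite /th1 -(redp_theta theta_or) (inclpM p_prime) !muE nuE cN -/(th2 g); ring.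
(* [mu] has the same cocycle defect [del] as [om] modulo p and depends only on [z - x]: subtracting
   it yields a cocycle without changing diagonal differences. *)
exists (fun g u x z => redp (om g u (z - x) x) - mu g (u, z - x)); split.
- exact: (loc_const_comp2 (fun o m u x z => redp (o u (z - x) x) - m (u, z - x)) lom lmu).
- move=> g h u x z; rewrite muM /= -(delE _ _ _ _ x) /del /act_pair /= -/(th1 g).
  have -> : z + c g - (x + a g) = z - x + d g by rewrite /d; ring.
  rewrite !(rD, rN, rM) (redp_theta theta_or) -/(th1 g); ring.
move=> g u x z; have -> : z + 1 - (x + 1) = z - x by ring.
rewrite omS rD /df rD rN (_ : x + (z - x) = z); last by ring.
ring.
Qed.
End Massey.

(** * Moments of untwisted cocycles *)

Section Affine.
Context (p : nat) (p_prime : prime p) (G : topologicalType) (PG : profinite_group G).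
Context (a b c : G -> 'Z_p) (W : G -> 'Z_p -> 'Z_p -> 'Z_p) (alpha gamma : G -> 'Z_p -> 'Z_p).
Hypotheses (lW : loc_const W) (lgamma : loc_const gamma).
Hypothesis cW : forall g h x z,
  W (pmul PG g h) x z = W g x z + W h (x + a g) (z + c g).
Hypothesis cgamma : forall g h z, gamma (pmul PG g h) z = gamma g z + gamma h (z + c g).
Hypothesis diagW : forall g x z, W g (x + 1) (z + 1) - W g x z = alpha g x - gamma g z.
Hypothesis sum_alpha : forall g, \sum_(x : 'Z_p) alpha g x = b g.
Hypothesis sum_gamma : forall g, \sum_(z : 'Z_p) gamma g z = b g.

(** Moments of [W] in x: [N] is the zeroth, [q] the first, and [P] the first moment of the translate
    by [x]. *)
Let N g z : 'Z_p := \sum_(i : 'Z_p) W g i z.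
Let P g x z : 'Z_p := \sum_(i : 'Z_p) i * W g (i + x) z.
Let q g z : 'Z_p := \sum_(i : 'Z_p) i * W g i z.

Let PE g x z : P g x z = q g z - x * N g z.
Proof.
rewrite /P /q /N mulr_sumr -sumrB -[RHS](sum_shiftZ x).
by apply: eq_bigr => i _; ring.
Qed.

(** When [diagW] is summed over x, the p equal terms [gamma g z] add up to 0, so the first
    difference of [N] is [b]. *)
Let NE g z : N g z = N g 0 + z * b g.
Proof.
suff: N g =1 fun z => N g 0 + z * b g by apply.
apply: eq_of_stepZ => [|{}z]; first by rewrite mul0r addr0.
have -> : N g (z + 1) - N g z = b g; last by ring.
rewrite {1}/N -(sum_shiftZ 1) -sumrB (eq_bigr _ (fun i _ => diagW g i z)).
by rewrite sumrB sum_alpha (sum_constZ p_prime) natp_eq0 // mul0r subr0.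
Qed.

Let Nc g h z : N (pmul PG g h) z = N g z + N h (z + c g).
Proof.
by rewrite /N (eq_bigr _ (fun i _ => cW g h i z)) big_split /=
  (sum_shiftZ _ (fun i => W h i _)).
Qed.

Let qc g h z : q (pmul PG g h) z = q g z + P h (a g) (z + c g).
Proof.
rewrite /q /P -big_split; apply: eq_bigr => i _ /=.
by rewrite cW mulrDr.
Qed.

(** Translating x along with z brings in [diagW]; the change of weight from [i] to [i + 1] costs a
    term [N g (z + 1)]. *)
Let qS g z : q g (z + 1) - q g z =
  \sum_(i : 'Z_p) i * alpha g i - (\sum_(i : 'Z_p) i) * gamma g z + N g 0 + (z + 1) * b g.
Proof.
have -> : q g (z + 1) = P g 1 (z + 1) + N g (z + 1) by rewrite PE; ring.
rewrite addrAC {1}/P /q -sumrB.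
rewrite (eq_bigr (fun i => i * alpha g i - i * gamma g z)) => [|i _]; last first.
  by rewrite -mulrBr diagW mulrBr.
by rewrite sumrB mulr_suml NE !addrA.
Qed.

(* For odd p the second difference of [q] in [z] is [b], which is cancelled by half
   the second moment of [gamma]; for p = 2 every function of [z] is affine. *)
Let correction : exists r : G -> 'Z_p -> 'Z_p,
  [/\ loc_const r, forall g h z, r (pmul PG g h) z = r g z + r h (z + c g) &
      forall g z, q g z - r g z =
        q g 0 - r g 0 + z * ((q g 1 - r g 1) - (q g 0 - r g 0))].
Proof.
have [p2|p_odd] := even_prime p_prime.
  exists (fun _ _ => 0); split=> [|g h z|g z]; first by move=> g; exact: filterE.
    by rewrite addr0.
  have [->|->] : z = 0 \/ z = 1.
    have : (z < p)%N by rewrite -[X in (_ < X)%N](Zp_cast (prime_gt1 p_prime)).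
    rewrite [X in (_ < X)%N]p2 -[in _ \/ _](natr_Zp z).
    by case: (z : nat) => [|[|//]] _; [left|right].
  - by rewrite mul0r addr0.
  - by rewrite mul1r addrCA subrr addr0.
have two_unit : (2%:R : 'Z_p) \is a GRing.unit.
  by rewrite unitZpE ?prime_gt1 // coprimen2.
pose half : 'Z_p := 2%:R^-1.
have half2 x : half * (x + x) = x.
  by rewrite -mulr2n -mulr_natl mulrA mulVr // mul1r.
(* The symmetry i -> -i; this removes the [gamma] term from [qS]. *)
have sum0 : \sum_(i : 'Z_p) i = 0 :> 'Z_p.
  rewrite -[LHS]half2; set e := \sum_(i : 'Z_p) i.
  have {2}-> : e = - e by rewrite -sumrN /e [LHS](reindex_inj oppr_inj).
  by rewrite subrr mulr0.
(* First and second moments of [gamma]. The second difference of [Q] in z is 2b, so that of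
   [half * Q] is [b], as for [q]. *)
pose E g z : 'Z_p := \sum_(i : 'Z_p) i * gamma g (i + z).
pose Q g z : 'Z_p := \sum_(i : 'Z_p) i * i * gamma g (i + z).
have ES g z : E g (z + 1) - E g z = - b g.
  rewrite /E -(sum_shiftZ 1 (fun i => i * gamma g (i + z))) -sumrB -(sum_gamma g).
  rewrite -(sum_shiftZ (z + 1) (gamma g)) -sumrN; apply: eq_bigr => i _.
  by rewrite -addrA (addrC 1 z); ring.
have EE g z : E g z = E g 0 - z * b g.
  suff: E g =1 fun z => E g 0 - z * b g by apply.
  apply: eq_of_stepZ => [|{}z]; first by rewrite mul0r subr0.
  by rewrite ES; ring.
have QS g z : Q g (z + 1) - Q g z = - b g - (E g (z + 1) + E g (z + 1)).
  rewrite /Q -(sum_shiftZ 1 (fun i => i * i * gamma g (i + z))) -sumrB -(sum_gamma g).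
  rewrite -(sum_shiftZ (z + 1) (gamma g)) /E -!sumrN -!big_split -sumrN -big_split /=; apply: eq_bigr => i _.
  by rewrite -addrA (addrC 1 z); ring.
exists (fun g z => half * Q g z); split=> [|g h z|g z].
- exact: (loc_const_comp (fun ga z => half * \sum_(i : 'Z_p) i * i * ga (i + z)) lgamma).
- rewrite -mulrDr /Q -big_split; congr (_ * _); apply: eq_bigr => i _ /=.
  by rewrite cgamma mulrDr addrA.
have stepE y : (q g (y + 1) - half * Q g (y + 1)) - (q g y - half * Q g y) =
    \sum_(i : 'Z_p) i * alpha g i + N g 0 + half * b g + E g 0.
  have -> : q g (y + 1) - half * Q g (y + 1) - (q g y - half * Q g y) =
    (q g (y + 1) - q g y) - half * (Q g (y + 1) - Q g y) by ring.
  rewrite qS sum0 QS mulrDr mulrN [half * - (_ + _)]mulrN half2 EE; ring.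
suff: (fun z => q g z - half * Q g z) =1 fun z => q g 0 - half * Q g 0 +
    z * (q g 1 - half * Q g 1 - (q g 0 - half * Q g 0)) by apply.
apply: eq_of_stepZ => [|y]; first by rewrite mul0r addr0.
have := stepE 0; rewrite add0r => ->; rewrite stepE; ring.
Qed.

(* The cochains are the coefficients of the function
   [sum_i i * W (x + i) z - r z = m0 + z m1 - x n0 - x z b]. *)
Lemma bilinear_part : exists m0 m1 n0 : G -> 'Z_p,
  [/\ [/\ loc_const m0, loc_const m1 & loc_const n0],
      forall g h, n0 (pmul PG g h) = n0 g + n0 h + c g * b h,
      forall g h, m1 (pmul PG g h) = m1 g + m1 h - a g * b h &
      forall g h, m0 (pmul PG g h) =
        m0 g + m0 h + c g * m1 h - a g * n0 h - a g * (c g * b h)].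
Proof.
have [r [lr cr rE]] := correction.
have lq : loc_const q.
  exact: (loc_const_comp (fun w z => \sum_(i : 'Z_p) i * w i z) lW).
pose f g z := q g z - r g z.
have fE g z : f g z = f g 0 + z * (f g 1 - f g 0) by exact: rE.
have fc g h z : f (pmul PG g h) z =
    f g z + f h (z + c g) - a g * (N h 0 + (z + c g) * b h).
  by rewrite /f qc cr PE NE; ring.
exists (f^~ 0), (fun g => f g 1 - f g 0), (N^~ 0); split.
- split.
  + exact: (loc_const_comp2 (fun qg rg => qg 0 - rg 0) lq lr).
  + exact: (loc_const_comp2 (fun qg rg => qg 1 - rg 1 - (qg 0 - rg 0)) lq lr).
  + exact: (loc_const_comp (fun w => \sum_(i : 'Z_p) w i 0) lW).
- by move=> g h; rewrite Nc add0r (NE h (c g)) addrA.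
- move=> g h; rewrite !fc (fE h (1 + c g)) (fE h (0 + c g)); ring.
- move=> g h; rewrite fc (fE h (0 + c g)); ring.
Qed.
End Affine.

(** * The unitriangular extension of three characters *)

Section Main.
Context (p : nat) (p_prime : prime p) (G : topologicalType) (PG : profinite_group G)
  (theta : G -> forall m : nat, 'Z_(p ^ m.+1)).
Hypotheses (theta_or : p_orientation PG theta) (H90 : formal_hilbert90 PG theta).

Let th1 : G -> 'Z_p := theta1 theta.

(** Under the substitution of [th1 g * u] for [u], the weight [u] absorbs the factor [th1 g]. *)
Lemma sum_untwist g (F : 'Z_p -> 'Z_p) :
  \sum_(u : 'Z_p) u * (th1 g * F (th1 g * u)) = \sum_(u : 'Z_p) u * F u.
Proof.
have thu : th1 g \is a GRing.unit := theta1_unit theta_or g.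
rewrite [RHS](reindex_inj (mulrI thu)) /=.
by apply: eq_bigr => u _; ring.
Qed.

(** [a13] and [a24] witness the vanishing of the cup products; [e13] and [e24] may differ from them,
    as the defining system is free to be chosen. *)
Lemma massey_of_cup (a b c a13 a24 : G -> 'Z_p) :
  is_char PG a -> is_char PG b -> is_char PG c ->
  loc_const a13 -> (forall g h, a13 (pmul PG g h) = a13 g + a13 h + a g * b h) ->
  loc_const a24 -> (forall g h, a24 (pmul PG g h) = a24 g + a24 h + b g * c h) ->
  exists e13 e24 e14 : G -> 'Z_p,
  [/\ [/\ loc_const e13, loc_const e24 & loc_const e14],
      forall g h, e13 (pmul PG g h) = e13 g + e13 h + a g * b h,
      forall g h, e24 (pmul PG g h) = e24 g + e24 h + b g * c h &
      forall g h, e14 (pmul PG g h) = e14 g + e14 h + a g * e24 h + e13 g * c h].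
Proof.
move=> ha hb hc l13 c13 l24 c24.
have [B hB redB] : exists2 B : G -> 'Z_p -> 'Z_(p ^ 2),
    tcocycle PG (theta2 theta) (act_mul theta) B & forall g u, redp (B g u) = u^-1 * b g.
  apply: (lift_mul p_prime theta_or H90); split.
    exact: (loc_const_comp (fun t u => u^-1 * t) hb.1).
  by move=> g h u; rewrite hb.2 mulrDr mulrA (theta1_mul_inv p_prime theta_or).
have [al hal sal] := norm_lift p_prime theta_or H90 ha hb l13 c13 hB redB.
(* [norm_lift] for [c] and [b] needs the defect [c g * b h]; the defect of the product [b * c] is
   the sum of both orders. *)
have l42 : loc_const (fun g => b g * c g - a24 g).
  exact: (loc_const_comp3 (fun r s t => r * s - t) hb.1 hc.1 l24).
have [ga hga sga] : exists2 gamma : G -> 'Z_p * 'Z_p -> 'Z_(p ^ 2),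
    tcocycle PG (theta2 theta) (act_pair theta c) gamma &
    forall g u, \sum_(x : 'Z_p) gamma g (u, x) = B g u.
  apply: (norm_lift p_prime theta_or H90 hc hb l42 _ hB redB) => g h.
  by rewrite hb.2 hc.2 c24; ring.
have [w [lw cw dw]] := diagonal_lift p_prime theta_or H90 ha hc hal hga
  (fun g u => etrans (sal g u) (esym (sga g u))).
(* By [sum_unitZ], the sign makes [proj] send [u^-1 * t] to [t]. *)
pose proj (F : 'Z_p -> 'Z_p) : 'Z_p := - \sum_(u : 'Z_p) u * F u.
have projD F F' : proj (fun u => F u + F' u) = proj F + proj F'.
  by rewrite /proj -opprD -big_split; congr (- _); apply: eq_bigr => u _; rewrite mulrDr.
have projB F F' : proj (fun u => F u - F' u) = proj F - proj F'.
  by rewrite /proj -opprD -sumrB; congr (- _); apply: eq_bigr => u _; rewrite mulrBr.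
have proj_th g F : proj (fun u => th1 g * F (th1 g * u)) = proj F.
  by rewrite /proj sum_untwist.
have projE F F' : F =1 F' -> proj F = proj F' by move=> /funext ->.
have proj_sum g (f : G -> 'Z_p * 'Z_p -> 'Z_(p ^ 2)) :
    (forall u, \sum_(x : 'Z_p) f g (u, x) = B g u) ->
    \sum_(x : 'Z_p) proj (fun u => redp (f g (u, x))) = b g.
  move=> sf; rewrite /proj sumrN exchange_big /=.
  rewrite (eq_bigr (fun u => u * u^-1 * b g)) => [|u _]; last first.
    by rewrite -mulr_sumr -(redp_sum p_prime) sf redB mulrA.
  by rewrite -mulr_suml (sum_unitZ p_prime) mulN1r opprK.
pose W g x z := proj (fun u => w g u x z).
pose A g x := proj (fun u => redp (al g (u, x))).
pose C g x := proj (fun u => redp (ga g (u, x))).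
have lW : loc_const W.
  exact: (loc_const_comp (fun v x z => proj (fun u => v u x z)) lw).
have lC : loc_const C.
  exact: (loc_const_comp (fun v x => proj (fun u => redp (v (u, x)))) hga.1).
have cW g h x z : W (pmul PG g h) x z = W g x z + W h (x + a g) (z + c g).
  rewrite /W -(proj_th g (fun u => w h u _ _)) -projD; apply: projE => u.
  exact: cw.
have cC g h z : C (pmul PG g h) z = C g z + C h (z + c g).
  rewrite /C -(proj_th g (fun u => redp (ga h (u, _)))) -projD; apply: projE => u.
  by rewrite hga.2 (redpD p_prime) (redpM p_prime) (redp_theta theta_or).
have dW g x z : W g (x + 1) (z + 1) - W g x z = A g x - C g z.
  by rewrite /W /A /C -!projB; apply: projE => u; exact: dw.
have [m0 [m1 [n0 [[l0 l1 ln] en e1 e0]]]] :=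
  bilinear_part p_prime lW lC cW cC dW
    (fun g => proj_sum g al (sal g)) (fun g => proj_sum g ga (sga g)).
(* [b * c - n0] again exchanges the order of [b] and [c]; in the third cochain [- m1 * c] trades the
   term [c g * m1 h] for [- m1 g * c h]. *)
exists (fun g => - m1 g), (fun g => b g * c g - n0 g), (fun g => m0 g - m1 g * c g).
split; first split.
- exact: (loc_const_comp (fun t => - t) l1).
- exact: (loc_const_comp3 (fun r s t => r * s - t) hb.1 hc.1 ln).
- exact: (loc_const_comp3 (fun r s t => r - s * t) l0 l1 hc.1).
- by move=> g h; rewrite e1; ring.
- by move=> g h; rewrite hb.2 hc.2 en; ring.
- by move=> g h; rewrite e0 e1 hc.2; ring.
Qed.
End Main.

(** * Cup products and Massey products *)

Lemma d1P (p : nat) (G : topologicalType) (PG : profinite_group G) (f : G -> 'Z_p)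
    (e : G * G -> 'Z_p) :
  d1 PG f = e <-> forall g h, f (pmul PG g h) = f g + f h - e (g, h).
Proof.
split=> [<- g h|fE]; first by rewrite /d1 /=; ring.
by apply/funext => -[g h]; rewrite /d1 /= fE; ring.
Qed.

Theorem theorem1p3 (p : nat) (G : topologicalType) (PG : profinite_group G)
  (theta : G -> forall m : nat, 'Z_(p ^ m.+1))
  (chi1 chi2 chi3 : G -> 'Z_p) :
  prime p ->
  p_orientation PG theta ->
  formal_hilbert90 PG theta ->
  cocycle1 PG chi1 -> cocycle1 PG chi2 -> cocycle1 PG chi3 ->
  (coboundary2 PG (cup11 chi1 chi2) /\ coboundary2 PG (cup11 chi2 chi3)
     <-> massey3_defined PG chi1 chi2 chi3) /\
  (massey3_defined PG chi1 chi2 chi3 <-> massey3_vanishes PG chi1 chi2 chi3).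
Proof.
move=> p_prime theta_or H90 [l1 d1E] [l2 d2E] [l3 d3E].
have charP (f : G -> 'Z_p) : loc_const f -> d1 PG f = (fun=> 0) -> is_char PG f.
  by move=> lf /d1P fM; split=> // g h; rewrite fM subr0.
(* The action is trivial, so [d0] is zero and a class in degree 1 has a single representative. *)
have reprE (f chi : G -> 'Z_p) : represents1 f chi -> f = chi.
  move=> [e /funeqP fE]; apply/funext => g.
  by have := fE g; rewrite /d0 subrr => /eqP; rewrite subr_eq0 => /eqP.
have repr_refl (chi : G -> 'Z_p) : represents1 chi chi.
  by exists 0; apply/funext => g; rewrite /d0 !subrr.
have cup_def : massey3_defined PG chi1 chi2 chi3 ->
    coboundary2 PG (cup11 chi1 chi2) /\ coboundary2 PG (cup11 chi2 chi3).
  move=> [a12 [a23 [a34 [a13 [a24 [[_ _ _ l13 l24] _ [r1 r2 r3] d13 d24]]]]]].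
  move: d13 d24; rewrite (reprE _ _ r1) (reprE _ _ r2) (reprE _ _ r3) => /d1P d13 /d1P d24.
  split; [exists (fun g => - a13 g)|exists (fun g => - a24 g)]; split.
  - exact: (loc_const_comp (fun t => - t) l13).
  - by apply/esym/d1P => g h; rewrite d13; ring.
  - exact: (loc_const_comp (fun t => - t) l24).
  - by apply/esym/d1P => g h; rewrite d24; ring.
have cup_vanish : coboundary2 PG (cup11 chi1 chi2) /\ coboundary2 PG (cup11 chi2 chi3) ->
    massey3_vanishes PG chi1 chi2 chi3.
  move=> [[f [lf /esym/d1P fE]] [f' [lf' /esym/d1P fE']]].
  have [||e13 [e24 [e14 [[m13 m24 m14] c13 c24 c14]]]] :=
    massey_of_cup p_prime theta_or H90 (charP _ l1 d1E) (charP _ l2 d2E) (charP _ l3 d3E)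
      (loc_const_comp (fun t => - t) lf) _ (loc_const_comp (fun t => - t) lf').
  - by move=> g h; rewrite fE /cup11 /=; ring.
  - by move=> g h; rewrite fE' /cup11 /=; ring.
  exists chi1, chi2, chi3, e13, e24; split; last first.
    exists e14; split=> //; apply/esym/d1P => g h.
    by rewrite c14 /ds_value3 /cup11 /=; ring.
  split=> //; apply/d1P => g h; first by rewrite c13 opprK.
  by rewrite c24 opprK.
have vanish_def : massey3_vanishes PG chi1 chi2 chi3 -> massey3_defined PG chi1 chi2 chi3.
  by move=> [a12 [a23 [a34 [a13 [a24 [h _]]]]]]; exists a12, a23, a34, a13, a24.
by split; split=> h; auto.
Qed.
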